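(* Let $S$ be a finite set of prime numbers, let $\mathbb{Z}[1/S]$ be the ring of $S$-integers of $\mathbb{Q}$, and let $\mathcal{X}=\mathbf{P}^1_{\mathbb{Z}}\setminus\{0,1,\infty\}=\operatorname{Spec}\mathbb{Z}[z]\left[\frac{1}{z(z-1)}\right]$. Then the set $\mathcal{X}(\mathbb{Z}[1/S])$ of $S$-integral points of $\mathcal{X}$ is finite.
   Context: $\mathbb{Z}[1/S]$ is the subring of $\mathbb{Q}$ obtained by inverting all primes in $S$. Concretely, $\mathcal{X}(\mathbb{Z}[1/S])$ is the set of $u\in\mathbb{Z}[1/S]^*$ such that $1-u\in\mathbb{Z}[1/S]^*$. *)

(* Defs.v *)
From HB Require Import structures.
From mathcomp Require Import all_boot all_order all_algebra.
From mathcomp Require Import boolp classical_sets functions cardinality.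

Set Implicit Arguments.
Unset Strict Implicit.
Unset Printing Implicit Defensive.

Import Order.TTheory GRing.Theory Num.Theory.
Local Open Scope classical_set_scope.
Local Open Scope ring_scope.

(* The localization of the integers at the multiplicative monoid generated by
   S: fractions m / n with n a finite product of elements of S. *)
Definition Sintegral (S : set nat) : {pred rat} :=
  fun x => `[< exists (m : int) (s : seq nat),
    (forall p, p \in s -> S p) /\
    x = m%:~R / ((\prod_(p <- s) p)%N)%:R >].

Lemma Sintegral_subring (S : set nat) : subring_closed (Sintegral S).
Proof.
split; first by apply/asboolP; exists 1, [::]; rewrite big_nil divr1.
- move=> _ _ /asboolP[m [s [sS ->]]] /asboolP[m' [s' [sS' ->]]]; apply/asboolP.
  set n := (\prod_(p <- s) p)%N; set n' := (\prod_(p <- s') p)%N.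
  have [n0|n0] := eqVneq (n%:R : rat) 0.
    by exists (- m'), s'; rewrite n0 invr0 mulr0 sub0r mulrNz mulNr.
  have [n'0|n'0] := eqVneq (n'%:R : rat) 0.
    by exists m, s; rewrite n'0 invr0 mulr0 subr0.
  exists (m * n'%:Z - m' * n%:Z), (s ++ s'); split.
    by move=> p; rewrite mem_cat => /orP[/sS|/sS'].
  rewrite big_cat -/n -/n' natrM intrD mulrNz !intrM -!pmulrn.
  by rewrite -mulNr addf_div // mulNr.
- move=> _ _ /asboolP[m [s [sS ->]]] /asboolP[m' [s' [sS' ->]]]; apply/asboolP.
  exists (m * m'), (s ++ s'); split.
    by move=> p; rewrite mem_cat => /orP[/sS|/sS'].
  by rewrite big_cat natrM intrM mulf_div.
Qed.

HB.instance Definition _ (S : set nat) :=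
  GRing.isSubringClosed.Build rat (Sintegral S) (Sintegral_subring S).

Record Sinteger (S : set nat) := MkSinteger {
  Sinteger_val :> rat;
  _ : Sinteger_val \in Sintegral S }.

HB.instance Definition _ (S : set nat) := [isSub for @Sinteger_val S].
HB.instance Definition _ (S : set nat) := [Choice of Sinteger S by <:].
HB.instance Definition _ (S : set nat) :=
  [SubChoice_isSubComNzRing of Sinteger S by <:].

Section Units.
Variable S : set nat.
Implicit Types x y : Sinteger S.

Definition Sinteger_unit : {pred Sinteger S} :=
  fun x => (val x != 0) && ((val x)^-1 \in Sintegral S).

Definition Sinteger_inv x : Sinteger S := insubd x (val x)^-1.

Fact Sinteger_mulVx : {in Sinteger_unit, left_inverse 1 Sinteger_inv *%R}.
Proof.
move=> x /andP[x0 xS]; apply: val_inj.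
by rewrite rmorphM rmorph1 /= insubdK // mulVf.
Qed.

Fact Sinteger_unitPl x y : y * x = 1 -> Sinteger_unit x.
Proof.
move=> yx; have yx1 : val y * val x = 1 by exact: (congr1 val yx).
have x0 : val x != 0.
  apply: contra_eq_neq yx1 => ->.
  by rewrite mulr0 eq_sym oner_neq0.
apply/andP; split=> //.
by rewrite -[_^-1]mul1r -yx1 mulfK //; exact: valP.
Qed.

Fact Sinteger_invr_out : {in [predC Sinteger_unit], Sinteger_inv =1 id}.
Proof.
move=> x; rewrite inE /= => /nandP[/negPn/eqP x0|xS]; apply: val_inj.
  by rewrite val_insubd x0 invr0 if_same.
by rewrite val_insubd (negPf xS).
Qed.

End Units.

HB.instance Definition _ (S : set nat) :=
  GRing.ComNzRing_hasMulInverse.Build (Sinteger S)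
    (@Sinteger_mulVx S) (@Sinteger_unitPl S) (@Sinteger_invr_out S).

(* The R-points of P^1 minus {0, 1, oo} = Spec Z[z][1/(z(z-1))], a point being
   identified with the image u of the coordinate z. *)
Definition P1minus3_points (R : comUnitRingType) : set R :=
  [set u | u \is a GRing.unit /\ 1 - u \is a GRing.unit].
Arguments P1minus3_points : clear implicits.

(* Main.v *)
Require Import Defs.
From HB Require Import structures.
From mathcomp Require Import all_boot all_order all_algebra.
From mathcomp Require Import boolp classical_sets functions cardinality.
From mathcomp Require Import zify ring.

Set Implicit Arguments.
Unset Strict Implicit.
Unset Printing Implicit Defensive.

Import Order.TTheory GRing.Theory Num.Theory.
Local Open Scope ring_scope.

(* After clearing denominators, a point is a relation a + b = c between coprime
   positive integers all of whose prime factors lie in S; the task is to bound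
   c. The method is that of Beukers and Schlickewei. Integrating
   X^N (X + a)^N (b - X)^N over [0, b], [-a, 0] and [-a, b] gives, for N odd and
   M = 2N + 1, a Pade-type relation
     c^M W(c, -a) = b^M W(b, a) - a^M W(a, b)
   where W has integer coefficients, degree N and size at most C^N c^N. If
   a' + b' = c' is another solution, with (a', b', c') close to
   (a^M, b^M, c^M) in the sense that the ratios have small numerators and
   denominators, then clearing denominators gives a second relation
   a^M xi + b^M eta = c^M kappa with xi, eta > 0. The 2 x 2 determinant of the
   two relations is nonzero and divisible by c^M, hence
     c^M <= W(a, b) eta + W(b, a) xi.
   This is impossible when c and N are large and xi, eta are at most
   c^(N/2), say. Call two solutions equivalent when their vectors of prime
   exponents, divided by log c, agree up to 1/K. There are finitely many
   classes, and two large solutions in one class whose heights have a large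
   ratio are close in the above sense for a suitable N; so the heights are
   bounded in each class. *)

(** * Formal integration of rational polynomials *)

Definition primitive (p : {poly rat}) : {poly rat} :=
  \poly_(i < (size p).+1) (p`_i.-1 / i%:R).

Lemma coef_primitive p i : (primitive p)`_i = p`_i.-1 / i%:R.
Proof.
(* At index 0 the division is by 0, and [0^-1 = 0] makes the constant term vanish. *)
rewrite coef_poly; case: i => [|i] /=; first by rewrite invr0 mulr0.
by rewrite ltnS; case: leqP => // /(nth_default _) ->; rewrite mul0r.
Qed.

Lemma primitive_is_linear : linear primitive.
Proof.
move=> a p q; apply/polyP=> i.
by rewrite coefD coefZ !coef_primitive coefD coefZ mulrDl mulrA.
Qed.

HB.instance Definition _ :=
  GRing.isLinear.Build rat {poly rat} {poly rat} *:%R primitive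
    primitive_is_linear.

Lemma deriv_primitive p : (primitive p)^`() = p.
Proof.
apply/polyP=> i; rewrite coef_deriv coef_primitive /= -[LHS]mulr_natr.
by rewrite mulfVK // pnatr_eq0.
Qed.

Lemma primitive_deriv p : primitive p^`() = p - (p.[0])%:P.
Proof.
apply/polyP=> i; rewrite coef_primitive coefB coefC coef_deriv horner_coef0.
case: i => [|i] /=; first by rewrite invr0 mulr0 subrr.
by rewrite subr0 -[X in X / _]mulr_natr mulfK // pnatr_eq0.
Qed.

Definition integral01 (p : {poly rat}) : rat := (primitive p).[1].

Lemma integral01_is_linear : linear_for *%R integral01.
Proof. by move=> a p q; rewrite /integral01 linearP hornerD hornerZ. Qed.

HB.instance Definition _ :=
  GRing.isLinear.Build rat {poly rat} rat *%R integral01 integral01_is_linear.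

Lemma integral01_deriv p : integral01 p^`() = p.[1] - p.[0].
Proof. by rewrite /integral01 primitive_deriv hornerD hornerN hornerC. Qed.

(** Substituting [u + (v - u) * X] brings every interval back to [0, 1], where beta integrals
    apply. *)
Lemma horner_sub_integral01 (p : {poly rat}) u v :
  p.[v] - p.[u] =
  (v - u) * integral01 (p^`() \Po (u%:P + (v - u) *: 'X)).
Proof.
rewrite -linearZ /=; set q := u%:P + _.
have -> : (v - u) *: (p^`() \Po q) = (p \Po q)^`().
  by rewrite deriv_comp derivD derivC derivZ derivX add0r -scalerAr mulr1.
rewrite integral01_deriv !horner_comp !(hornerD, hornerC, hornerZ, hornerX).
by rewrite mulr1 mulr0 addr0 [u + _]addrC subrK.
Qed.

(** Integration by parts, by induction on [b]: ['X^(a.+1) * (1 - 'X) ^+ b.+1] vanishes at 0 and 1,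
    so its derivative has integral 0. *)
Lemma integral01_beta a b :
  integral01 ('X^a * (1 - 'X) ^+ b) = (a`! * b`!)%:R / ((a + b).+1)`!%:R.
Proof.
elim: b a => [|b IHb] a.
  rewrite expr0 mulr1 addn0 /integral01.
  have -> : primitive 'X^a = a.+1%:R^-1 *: 'X^(a.+1).
    apply/polyP=> i; rewrite coef_primitive coefZ !coefXn.
    case: i => [|i] /=; first by rewrite invr0 !mulr0.
    by rewrite eqSS; case: eqP => [->|_]; rewrite ?mul1r ?mulr1 ?mul0r ?mulr0.
  rewrite hornerZ hornerXn expr1n mulr1 fact0 muln1 factS natrM invfM mulrCA.
  by rewrite divff ?mulr1 // pnatr_eq0 -lt0n fact_gt0.
have : integral01 (('X^(a.+1) * (1 - 'X) ^+ b.+1)^`()) = 0.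
  rewrite integral01_deriv !hornerE /= subrr !expr0n /= !(mulr0, mul0r).
  by rewrite subr0.
have -> : ('X^(a.+1) * (1 - 'X) ^+ b.+1)^`() =
    a.+1%:R *: ('X^a * (1 - 'X) ^+ b.+1)
    - b.+1%:R *: ('X^(a.+1) * (1 - 'X) ^+ b) :> {poly rat}.
  rewrite derivM derivXn deriv_exp derivB derivC derivX sub0r /=.
  by rewrite !scaler_nat mulrnAl mulN1r mulNrn mulrN mulrnAr.
rewrite linearB !linearZ /= IHb => /eqP; rewrite subr_eq0 => /eqP H.
have a0 : a.+1%:R != 0 :> rat by rewrite pnatr_eq0.
apply: (mulfI a0); rewrite H addnS addSn !factS !natrM; ring.
Qed.

(** * The Pade-type polynomials W *)

Definition Wpoly (R : pzSemiRingType) (N : nat) (x y : R) : R :=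
  \sum_(j < N.+1) ('C((3 * N).+1, N - j) * 'C(N + j, j))%:R
    * (x ^+ j * y ^+ (N - j)).

(** Lets the same W be read in [nat] for sizes, in [int] for divisibility and in [rat] for
    integration. *)
Lemma rmorph_Wpoly (R R' : pzSemiRingType) (f : {rmorphism R -> R'}) N x y :
  Wpoly N (f x) (f y) = f (Wpoly N x y).
Proof.
rewrite rmorph_sum; apply: eq_bigr => j _.
by rewrite rmorphM rmorph_nat rmorphM !rmorphXn.
Qed.

(** Expand the last factor and integrate termwise with the beta formula; the factorial prefactor
    turns every coefficient into a product of two binomials, hence an integer. *)
Lemma integral01_Wpoly N x y :
  ((3 * N).+1)`!%:R / (N`! ^ 3)%:R
    * integral01 ('X^N * (1 - 'X) ^+ N * (y%:P + x *: 'X) ^+ N)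
  = Wpoly N x y.
Proof.
rewrite [(y%:P + _) ^+ N]exprDn mulr_sumr linear_sum mulr_sumr; apply: eq_bigr => j _.
have jN : (j <= N)%N by rewrite -ltnS.
have -> : 'X^N * (1 - 'X) ^+ N * ((y%:P ^+ (N - j) * (x *: 'X) ^+ j) *+ 'C(N, j))
  = ('C(N, j)%:R * (x ^+ j * y ^+ (N - j))) *: ('X^(N + j) * (1 - 'X) ^+ N)
  :> {poly rat}.
  rewrite -!mul_polyC exprMn exprD -[X in _ * X]mulr_natr !rmorphM !rmorphXn /=.
  rewrite rmorph_nat; set e := (1 - 'X) ^+ N; set f := 'X ^+ N; set g := 'X ^+ j.
  by set h := y%:P ^+ _; set k := x%:P ^+ _; set c := _%:R; ring.
rewrite linearZ /= integral01_beta mulrCA [RHS]mulrC -mulrA mulrCA -mulrA.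
rewrite [RHS]mulrC mulrC -!mulrA; congr (_ * (_ * _)); rewrite !mulrA.
have f0 n : n`!%:R != 0 :> rat by rewrite pnatr_eq0 -lt0n fact_gt0.
have H1 : 'C(N, j)%:R = N`!%:R / (j`!%:R * (N - j)`!%:R) :> rat.
  by rewrite -(bin_fact jN) !natrM mulfK // mulf_neq0.
have H2 : 'C((3 * N).+1, N - j)%:R =
    ((3 * N).+1)`!%:R / ((N - j)`!%:R * (N + j + N).+1`!%:R) :> rat.
  have le : (N - j <= (3 * N).+1)%N.
    by rewrite (leq_trans (leq_subr _ _)) // ltnW // ltnS leq_pmull.
  have := f0 (N + j + N).+1; rewrite -(bin_fact le).
  have -> : ((3 * N).+1 - (N - j) = (N + j + N).+1)%N by lia.
  move: ((N + j + N).+1)`! => F F0.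
  by rewrite !natrM mulfK // mulf_neq0.
have H3 : 'C(N + j, j)%:R = (N + j)`!%:R / (j`!%:R * N`!%:R) :> rat.
  by rewrite -(bin_fact (leq_addl N j)) addnK !natrM mulfK // mulf_neq0.
rewrite natrX [('C(_, _) * 'C(_, _))%:R]natrM H1 H2 H3 [(_`! * _`!)%:R]natrM.
have := (f0 N, f0 j, f0 (N - j)%N, f0 (N + j)%N, f0 (N + j + N).+1,
  f0 (3 * N).+1).
move: N`!%:R j`!%:R (N - j)`!%:R (N + j)`!%:R ((N + j + N).+1)`!%:R
  (((3 * N).+1)`!%:R).
move=> x1 x2 x3 x4 x5 x6 [[[[[h1 h2] h3] h4] h5] h6]; field.
by rewrite h1 h2 h3 h5.
Qed.

(** Additivity of the integral of [g] at the points -a, 0, b. The two factors vanishing at the ends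
    of an interval and the differential give its length to the power 2N + 1, up to sign; the third
    factor gives W. *)
Lemma Wpoly_rat_identity N (a b : rat) :
  (a + b) ^+ (2 * N).+1 * Wpoly N (a + b) (- a) =
  b ^+ (2 * N).+1 * Wpoly N b a + (-1) ^+ N * a ^+ (2 * N).+1 * Wpoly N a b.
Proof.
pose g : {poly rat} := 'X^N * ('X + a%:P) ^+ N * (b%:P - 'X) ^+ N.
have comp_g q : g \Po q = q ^+ N * (q + a%:P) ^+ N * (b%:P - q) ^+ N.
  rewrite /g !rmorphM !rmorphXn /= comp_polyD comp_polyB !comp_polyC.
  by rewrite !comp_polyX.
pose G := primitive g.
pose w x y := integral01 ('X^N * (1 - 'X) ^+ N * (y%:P + x *: 'X) ^+ N).
have G0b : G.[b] - G.[0] = b * (b ^+ N * b ^+ N * w b a).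
  rewrite horner_sub_integral01 deriv_primitive comp_g subr0 polyC0 add0r.
  congr (_ * _); rewrite -linearZ; congr integral01 => /=.
  rewrite -!mul_polyC !rmorphM !rmorphXn /= -!exprMn; congr (_ ^+ _); ring.
have G0a : G.[- a] - G.[0] =
    - a * ((-1) ^+ N * (a ^+ N * a ^+ N) * w a b).
  rewrite horner_sub_integral01 deriv_primitive comp_g subr0 polyC0 add0r.
  congr (_ * _); rewrite -linearZ; congr integral01 => /=.
  rewrite -!mul_polyC !rmorphM !rmorphXn /= -!exprMn; congr (_ ^+ _).
  rewrite !rmorphN /= polyC1; ring.
have Gab : G.[b] - G.[- a] =
    (a + b) * ((a + b) ^+ N * (a + b) ^+ N * w (a + b) (- a)).
  rewrite horner_sub_integral01 deriv_primitive comp_g opprK [b + a]addrC.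
  congr (_ * _); rewrite -linearZ; congr integral01 => /=.
  rewrite -!mul_polyC !rmorphM !rmorphXn /= -!exprMn; congr (_ ^+ _).
  rewrite !rmorphN !rmorphD /=; ring.
rewrite -!integral01_Wpoly -/(w (a + b) (- a)) -/(w b a) -/(w a b).
have exp2 (x : rat) : x ^+ (2 * N).+1 = x * (x ^+ N * x ^+ N).
  by rewrite exprS mul2n -addnn exprD.
rewrite !exp2; set D := _ / _.
have GE : G.[b] - G.[- a] = (G.[b] - G.[0]) - (G.[- a] - G.[0]) by ring.
rewrite Gab G0b G0a in GE.
move: GE; move: (w (a + b) (- a)) (w b a) (w a b) D => wc wb wa D.
move: ((a + b) ^+ N) (a ^+ N) (b ^+ N) ((-1) ^+ N) => cN aN bN sN GE.
transitivity (D * ((a + b) * (cN * cN * wc))); first by ring.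
by rewrite GE; ring.
Qed.

Lemma Wpoly_int_identity N (a b : int) :
  (a + b) ^+ (2 * N).+1 * Wpoly N (a + b) (- a) =
  b ^+ (2 * N).+1 * Wpoly N b a + (-1) ^+ N * a ^+ (2 * N).+1 * Wpoly N a b.
Proof.
apply: (@intr_inj rat); have H := Wpoly_rat_identity N a%:~R b%:~R.
rewrite [LHS]rmorphM [RHS]rmorphD !rmorphM !rmorphXn -!rmorph_Wpoly.
by rewrite !rmorphN !rmorphD rmorph1.
Qed.

Local Open Scope nat_scope.

(** * Size of W and the determinant bound *)

Lemma Wpoly_nat_le N a b : Wpoly N a b <= 2 ^ (6 * N).+1 * (a + b) ^ N.
Proof.
have bin_le m k : 'C(m, k) <= 2 ^ m.
  case: (leqP k m) => [km|/bin_small -> //].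
  rewrite -[2]/(1 + 1) Pascal (bigD1 (inord k)) //= inordK //.
  by rewrite !exp1n !muln1 leq_addr.
have exp_le x y k : x <= y -> x ^ k <= y ^ k.
  by case: k => // k; rewrite leq_exp2r.
(* The binomials are at most [2 ^ (3 * N).+1] and [2 ^ (2 * N)], and the number of terms is at most
   [2 ^ N]. *)
apply: (@leq_trans (\sum_(j < N.+1) 2 ^ (5 * N).+1 * (a + b) ^ N)).
  apply: leq_sum => j _; have jN : j <= N by rewrite -ltnS.
  rewrite natn; apply: leq_mul.
    rewrite (leq_trans (leq_mul (bin_le _ _) (bin_le _ _))) //.
    by rewrite -expnD leq_pexp2l //; lia.
  rewrite -[in leqRHS](subnKC jN) expnD.
  by rewrite leq_mul ?exp_le ?leq_addr ?leq_addl.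
rewrite sum_nat_const card_ord mulnA leq_mul //.
apply: leq_trans (leq_mul (ltn_expl N (ltnSn 1)) (leqnn _)) _.
by rewrite -expnD leq_pexp2l //; lia.
Qed.

(* The relation [b ^ M * W b a = a ^ M * W a b] modulo [(a + b) ^ M] has the
   opposite sign of the one satisfied by [(xi, eta)], so the two are
   independent, and their determinant [W a b * eta + W b a * xi] is a positive
   multiple of [(a + b) ^ M]. *)
Lemma Wpoly_determinant_ge N a b xi eta :
  odd N -> coprime a (a + b) -> 0 < a -> 0 < b -> 0 < xi ->
  (a + b) ^ (2 * N).+1 %| a ^ (2 * N).+1 * xi + b ^ (2 * N).+1 * eta ->
  (a + b) ^ (2 * N).+1 <= Wpoly N a b * eta + Wpoly N b a * xi.
Proof.
move=> oN cop a0 b0 xi0 /dvdnP[kappa E].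
have Wpos : 0 < Wpoly N b a.
  rewrite /Wpoly big_ord_recl /= ltn_addr // natn subn0 addn0 bin0 muln1 expr0 mul1r.
  by rewrite muln_gt0 bin_gt0 expn_gt0 a0 andbT; lia.
apply: dvdn_leq; first by rewrite addn_gt0 orbC muln_gt0 Wpos xi0.
set M := (2 * N).+1 in E *.
rewrite -(@Gauss_dvdr _ (a ^ M)); last by rewrite coprimeXl // coprimeXr // coprime_sym.
have /= := Wpoly_int_identity N a%:R b%:R.
rewrite -signr_odd oN expr1 mulN1r -!natrD -/M => H.
have HW x y : Wpoly N x%:R y%:R = (Wpoly N x y)%:R :> int :=
  rmorph_Wpoly (GRing.natmul 1) N x y.
rewrite !HW in H.
suff : ((((a + b) ^ M)%N%:R : int) %| (a ^ M * (Wpoly N a b * eta + Wpoly N b a * xi))%N%:R)%Z.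
  by rewrite !pmulrn !intz dvdzE.
(* Eliminate [b ^ M]: take [Wpoly N b a] times the relation [E] and subtract [eta] times the Pade
   relation. *)
apply/dvdzP; exists ((Wpoly N b a * kappa)%N%:R
   - Wpoly N (a + b)%:R (- a%:R) * eta%:R)%R.
have /(congr1 (GRing.natmul (1%R : int))) := E.
rewrite !natrM !natrD !natrM !natrX -[(a%:R + b%:R)%R]natrD => E'.
move: (Wpoly N (a + b)%:R _) H E' => Wc.
move: (Wpoly N a b) (Wpoly N b a) (a + b) => Wa Wb c.
move: (c%:R ^+ M)%R (a%:R ^+ M)%R (b%:R ^+ M)%R => cM aM bM H E'.
transitivity (Wb%:R * (aM * xi%:R + bM * eta%:R)
  - (bM * Wb%:R + - aM * Wa%:R) * eta%:R : int)%R; first by ring.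
by rewrite -H E'; ring.
Qed.

(** * Prime exponents of smooth numbers *)

Lemma prod_logn_supp (s : seq nat) n : uniq s -> 0 < n ->
  (forall p, prime p -> p %| n -> p \in s) ->
  n = \prod_(p <- s) p ^ logn p n.
Proof.
move=> us n_gt0 sn.
have nn : [pred p | p \in s].-nat n.
  by apply/pnatP => // p pp pn; rewrite inE sn.
(* A range large enough to contain all of [s]. *)
pose m := n + \sum_(p <- s) p.
rewrite -{1}(part_pnat_id nn) (widen_partn _ (leq_addr _ _ : n <= m)).
rewrite -big_filter; apply: perm_big; apply: uniq_perm => //.
  by rewrite filter_uniq ?iota_uniq.
move=> p; rewrite mem_filter mem_index_iota inE /=.
case ps: (p \in s) => /=; last by [].
by rewrite /m ltnS (big_rem p) //= addnCA leq_addr.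
Qed.

(** Subtraction being truncated, both sides raise [p] to the maximum of [e p] and [f p]. *)
Lemma mul_prod_expB (s : seq nat) (e f : nat -> nat) :
  (\prod_(p <- s) p ^ f p) * \prod_(p <- s) p ^ (e p - f p) =
  (\prod_(p <- s) p ^ e p) * \prod_(p <- s) p ^ (f p - e p).
Proof.
rewrite -!big_split; apply: eq_bigr => p _ /=.
by rewrite -!expnD -!maxnE maxnC.
Qed.

Lemma prod_exp_le (s : seq nat) (e : nat -> nat) t :
  (forall p, p \in s -> 0 < p /\ e p <= t) ->
  \prod_(p <- s) p ^ e p <= (\prod_(p <- s) p) ^ t.
Proof.
elim: s => [|p s IHs] H; first by rewrite !big_nil exp1n.
rewrite !big_cons expnMn leq_mul //; last first.
  by apply: IHs => q qs; apply: H; rewrite inE qs orbT.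
by have [p0 pt] := H p (mem_head _ _); rewrite leq_pexp2l.
Qed.

Lemma prod_exp_gt0 (s : seq nat) (e : nat -> nat) :
  (forall p, p \in s -> 0 < p) -> 0 < \prod_(p <- s) p ^ e p.
Proof.
by move=> s0; rewrite big_seq prodn_cond_gt0 // => p /s0 p0; rewrite expn_gt0 p0.
Qed.

(** Write [v / u ^ M] as [n / d], where [n] collects the exponents in excess and [d] those in
    deficit. *)
Lemma smooth_power_approx (s : seq nat) u v M t : uniq s ->
  (forall p, p \in s -> 0 < p) -> 0 < u -> 0 < v ->
  (forall p, prime p -> p %| u -> p \in s) ->
  (forall p, prime p -> p %| v -> p \in s) ->
  (forall p, p \in s -> logn p v - M * logn p u <= t) ->
  (forall p, p \in s -> M * logn p u - logn p v <= t) ->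
  exists n d, [/\ 0 < n, 0 < d, n <= (\prod_(p <- s) p) ^ t,
    d <= (\prod_(p <- s) p) ^ t & v * d = u ^ M * n].
Proof.
move=> us s0 u0 v0 su sv h1 h2.
exists (\prod_(p <- s) p ^ (logn p v - M * logn p u)).
exists (\prod_(p <- s) p ^ (M * logn p u - logn p v)).
split; [exact: prod_exp_gt0|exact: prod_exp_gt0| | |].
- by apply: prod_exp_le => p ps; split; [exact: s0|exact: h1].
- by apply: prod_exp_le => p ps; split; [exact: s0|exact: h2].
rewrite {1}(prod_logn_supp us v0 sv) (mul_prod_expB _ (fun p => M * logn p u)).
congr (_ * _); rewrite [in RHS](prod_logn_supp us u0 su).
rewrite (big_morph (expn^~ M) (fun x y => expnMn x y M) (exp1n M)).
by apply: eq_bigr => p _; rewrite mulnC expnM.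
Qed.

(** The term [4 * L] pays for replacing [L' / L] by [M]; the other one is the cell width [1 / K]
    scaled by [L']. *)
Lemma pigeonhole_exponents K L L' M e e' : 0 < K -> 0 < L -> 0 < L' ->
  M * L <= L' -> L' < (M + 4) * L -> e <= L ->
  (K * e) %/ L = (K * e') %/ L' ->
  (e' - M * e <= 4 * L + ((M + 4) * L) %/ K) /\
  (M * e - e' <= 4 * L + ((M + 4) * L) %/ K).
Proof.
move=> K0 L0 L'0 le_ML lt_L' eL Eq; set q := (K * e) %/ L in Eq.
have qK : q <= K.
  by rewrite /q -[leqRHS](mulnK K L0) leq_div2r // leq_mul2l eL orbT.
have l1 : q * L <= K * e by apply: leq_trunc_div.
have l2 : K * e < q.+1 * L by apply: ltn_ceil.
have l3 : q * L' <= K * e' by rewrite Eq; apply: leq_trunc_div.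
have l4 : K * e' < q.+1 * L' by rewrite Eq; apply: ltn_ceil.
set d := L' - M * L; have dL : d <= 4 * L by rewrite /d; lia.
have L'E : L' = M * L + d by rewrite /d subnKC.
have qd : q * d <= 4 * L * K by rewrite mulnC leq_mul.
have M1 : M * (q * L) <= M * (K * e) by rewrite leq_mul2l l1 orbT.
have M2 : M * (K * e) <= M * (q.+1 * L) by rewrite leq_mul2l (ltnW l2) orbT.
rewrite L'E in l3 l4 lt_L'.
split; rewrite -leq_subLR leq_divRL //; lia.
Qed.

(** * Heights and classes of smooth sums *)

Definition smooth_sum (s : seq nat) (a b : nat) : Prop :=
  [/\ 0 < a, 0 < b, coprime a b &
      forall p, prime p -> p %| a * b * (a + b) -> p \in s].

Definition height (a b : nat) : nat := trunc_log 2 (a + b).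

(** The grid cell of mesh [1 / K] containing the normalized exponents at [p]; equal profiles define
    the classes. *)
Definition profile (K a b p : nat) : nat * nat * nat :=
  let q x := (K * logn p x) %/ height a b in (q a, q b, q (a + b)).

Lemma logn_le_trunc_log p x c : 0 < x <= c -> logn p x <= trunc_log 2 c.
Proof.
case/andP=> x0 xc; case pp: (prime p); last by rewrite lognE pp.
rewrite -ltnS -(ltn_exp2l _ _ (ltnSn 1)).
apply: leq_ltn_trans (trunc_log_ltn _ (ltnSn 1)); apply: leq_trans xc.
apply: leq_trans (dvdn_leq x0 (pfactor_dvdnn p x)).
case: (logn p x) => // k; rewrite leq_exp2r //; exact: prime_gt1.
Qed.

(** A larger ratio of heights would allow an odd [N > 32 * g] violating the determinant bound. With
    mesh [1 / (24 * g)], rounding costs only about a quarter of [L * N] in the exponent of 2. *)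
Lemma smooth_sum_ratio_lt (s : seq nat) g a b a' b' :
  uniq s -> (forall p, p \in s -> 0 < p) -> 0 < g ->
  \prod_(p <- s) p <= 2 ^ g ->
  smooth_sum s a b -> smooth_sum s a' b' ->
  (forall p, p \in s -> profile (24 * g) a b p = profile (24 * g) a' b' p) ->
  16 <= height a b -> height a' b' < (64 * g + 12) * height a b.
Proof.
move=> us s0 g0 Qg [a0 b0 cop sm] [a'0 b'0 _ sm'] prof.
rewrite /profile in prof.
set L := height a b in prof *; set L' := height a' b' in prof * => L16.
rewrite ltnNge; apply/negP => RL.
have L0 : 0 < L by rewrite (leq_trans _ L16).
have L'0 : 0 < L' by apply: leq_trans RL; rewrite muln_gt0 L0 andbT; lia.
(* [N] odd forces [M] to be 3 modulo 4; this is the largest such [M] up to [L' %/ L], whence the gap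
   of 4. *)
pose k := (L' %/ L - 3) %/ 4; pose N := (2 * k).+1; pose M := (2 * N).+1.
have q_ge : 64 * g + 12 <= L' %/ L by rewrite leq_divRL.
have le_M : M <= L' %/ L by rewrite /M /N /k; lia.
have lt_M : L' %/ L < M + 4 by rewrite /M /N /k; lia.
have NG : 32 * g < N by move: lt_M q_ge; rewrite /M; lia.
have ML : M * L <= L' by rewrite -leq_divRL.
have L'M : L' < (M + 4) * L by rewrite -ltn_divLR.
have K0 : 0 < 24 * g by lia.
pose t := 4 * L + ((M + 4) * L) %/ (24 * g).
have approx x x' : 0 < x <= a + b -> 0 < x' ->
    (forall p, prime p -> p %| x -> p \in s) ->
    (forall p, prime p -> p %| x' -> p \in s) ->
    (forall p, p \in s ->
      (24 * g * logn p x) %/ L = (24 * g * logn p x') %/ L') ->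
    exists n d, [/\ 0 < n, 0 < d, n <= (\prod_(p <- s) p) ^ t,
      d <= (\prod_(p <- s) p) ^ t & x' * d = x ^ M * n].
  move=> xc x'0 sx sx' px; have [x0 _] := andP xc.
  have H p : p \in s -> _ := fun ps => pigeonhole_exponents K0 L0 L'0 ML L'M
    (logn_le_trunc_log p xc) (px p ps).
  by apply: smooth_power_approx => // p /H[].
have [|//| | | |na [da [na0 da0 naQ daQ Ea]]] := approx a a'.
- by rewrite a0 leq_addr.
- by move=> p pp pa; apply: sm; rewrite // -mulnA dvdn_mulr.
- by move=> p pp pa; apply: sm'; rewrite // -mulnA dvdn_mulr.
- by move=> p /prof[].
have [|//| | | |nb [db [nb0 db0 nbQ dbQ Eb]]] := approx b b'.
- by rewrite b0 leq_addl.
- by move=> p pp pa; apply: sm; rewrite // mulnAC dvdn_mull.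
- by move=> p pp pa; apply: sm'; rewrite // mulnAC dvdn_mull.
- by move=> p /prof[].
have [||| | |nc [dc [nc0 dc0 ncQ dcQ Ec]]] := approx (a + b) (a' + b').
- by rewrite leqnn addn_gt0 a0.
- by rewrite addn_gt0 a'0.
- by move=> p pp pa; apply: sm; rewrite // dvdn_mull.
- by move=> p pp pa; apply: sm'; rewrite // dvdn_mull.
- by move=> p /prof[].
set c := a + b in Ec.
(* Multiply [a' + b' = c'] by [da * db * dc]. *)
have dvd : c ^ M %| a ^ M * (na * db * dc) + b ^ M * (nb * da * dc).
  apply/dvdnP; exists (nc * da * db).
  transitivity ((a' * da) * db * dc + (b' * db) * da * dc).
    by rewrite Ea Eb; ring.
  transitivity (((a' + b') * dc) * da * db); first by ring.
  by rewrite Ec; ring.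
have Qt : (\prod_(p <- s) p) ^ t <= 2 ^ (g * t).
  rewrite expnM; case: (t) => // t'; by rewrite leq_exp2r.
have T3 x y z : x <= (\prod_(p <- s) p) ^ t -> y <= (\prod_(p <- s) p) ^ t ->
    z <= (\prod_(p <- s) p) ^ t -> x * y * z <= 2 ^ (3 * (g * t)).
  move=> /leq_trans/(_ Qt) hx /leq_trans/(_ Qt) hy /leq_trans/(_ Qt) hz.
  by rewrite [3 * _]mulnC expnM !expnS expn0 muln1 mulnA !leq_mul.
have := Wpoly_determinant_ge (N := N) (a := a) (b := b)
  (xi := na * db * dc) (eta := nb * da * dc).
rewrite -/M -/c => /(_ _ _ a0 b0 _ dvd) H.
have {}H : c ^ M <= Wpoly N a b * (nb * da * dc) + Wpoly N b a * (na * db * dc).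
  apply: H; first by rewrite /N /= mul2n odd_double.
    by rewrite /c /coprime gcdnDl.
  by rewrite !muln_gt0 na0 db0 dc0.
have {H} : c ^ M <= 2 ^ (6 * N + 2 + 3 * (g * t)) * c ^ N.
  apply: leq_trans H _.
  have -> : 2 ^ (6 * N + 2 + 3 * (g * t)) * c ^ N =
     2 ^ (6 * N).+1 * c ^ N * 2 ^ (3 * (g * t)) +
     2 ^ (6 * N).+1 * c ^ N * 2 ^ (3 * (g * t)).
    by rewrite addn2 !expnD !expnS; ring.
  apply: leq_add; apply: leq_mul (T3 _ _ _ _ _ _) => //.
    exact: Wpoly_nat_le.
  by rewrite /c addnC; apply: Wpoly_nat_le.
have c0 : 0 < c by rewrite addn_gt0 a0.
have -> : M = N.+1 + N by rewrite /M; lia.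
rewrite expnD leq_pmul2r ?expn_gt0 ?c0 // => H.
have {H} : 2 ^ (L * N.+1) <= 2 ^ (6 * N + 2 + 3 * (g * t)).
  by apply: leq_trans H; rewrite expnM leq_exp2r // trunc_logP.
rewrite leq_exp2l // => H.
(* Times 8, [H] reads 8L(N+1) <= 48N + 16 + 24gt. The next three bounds make the right side at most
   8LN + 5L + 16, against [16 <= L]. *)
have t_le : 24 * (g * t) <= 96 * (g * L) + (M + 4) * L.
  rewrite /t mulnDr mulnDr; apply: leq_add; first by lia.
  by rewrite mulnA mulnC leq_trunc_div.
have P1 : 16 * N <= L * N by rewrite leq_mul2r L16 orbT.
have P2 : 32 * (g * L) <= N * L by rewrite mulnA leq_mul2r ltnW ?orbT.
rewrite /M in t_le; lia.
Qed.

(** Classes embed in a finite type. In each, one member of height at least 16 bounds all others;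
    without such a member 16 is a bound. *)
Lemma smooth_sum_height_bounded (s : seq nat) :
  uniq s -> (forall p, p \in s -> 0 < p) ->
  exists B, forall a b, smooth_sum s a b -> height a b <= B.
Proof.
(* The successor keeps [g] positive when the product is 1. *)
move=> us s0; pose g := (up_log 2 (\prod_(p <- s) p)).+1.
have Qg : \prod_(p <- s) p <= 2 ^ g.
  by rewrite (leq_trans (up_logP _ (ltnSn 1))) // leq_pexp2l.
pose K := 24 * g; pose box := ('I_K.+1 * 'I_K.+1 * 'I_K.+1)%type.
pose inbox (u : nat * nat * nat) : box := (inord u.1.1, inord u.1.2, inord u.2).
pose cl a b := [ffun i : 'I_(size s) => inbox (profile K a b (nth 0 s i))].
(* Ensures that [inord] loses nothing; at height 0 the quotient is 0 by convention. *)
have quo_le p x a b : 0 < x <= a + b -> (K * logn p x) %/ height a b < K.+1.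
  move=> xc; have := logn_le_trunc_log p xc; rewrite -/(height a b) => le_h.
  case: (posnP (height a b)) => [->|h0]; first by rewrite divn0.
  by rewrite ltnS -[leqRHS](mulnK K h0) leq_div2r // leq_mul2l le_h orbT.
have clP a b a' b' : smooth_sum s a b -> smooth_sum s a' b' ->
    cl a b = cl a' b' ->
    forall p, p \in s -> profile K a b p = profile K a' b' p.
  move=> [a0 b0 _ _] [a'0 b'0 _ _] /ffunP eq_cl p ps.
  have ip : index p s < size s by rewrite index_mem.
  have := eq_cl (Ordinal ip); rewrite !ffunE /= nth_index // /inbox /profile /=.
  move=> [] /(congr1 val) e1 /(congr1 val) e2 /(congr1 val) e3.
  move: e1 e2 e3; rewrite /= !inordK ?quo_le ?leq_addr ?leq_addl ?leqnn ?addn_gt0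
    ?a0 ?b0 ?a'0 ?b'0 //.
  by move=> -> -> ->.
have cl_bound k : exists B, forall a b, smooth_sum s a b -> cl a b = k ->
    height a b <= B.
  case: (pselect (exists a b, [/\ smooth_sum s a b, cl a b = k &
      16 <= height a b])) => [[a [b [sab clab h16]]]|none].
    exists ((64 * g + 12) * height a b) => a' b' sab' clab'.
    apply/ltnW/(smooth_sum_ratio_lt us s0 _ Qg sab sab') => //.
    by apply: clP => //; rewrite clab clab'.
  exists 16 => a b sab clab; rewrite leqNgt; apply/negP => h16.
  by apply: none; exists a, b; split=> //; apply: ltnW.
have [B BP] := fin_all_exists cl_bound.
exists (\max_k B k) => a b sab.
exact: leq_trans (BP _ _ _ sab erefl) (leq_bigmax _).
Qed.

(** * From integral points to smooth sums *)

Lemma Sintegral_div_supp (S : set nat) (A B : int) :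
  (forall p, S p -> prime p) -> A != 0%R -> coprimez A B ->
  (B%:~R / A%:~R)%R \in Sintegral S ->
  forall p, prime p -> p %| `|A| -> S p.
Proof.
move=> Sp A0 cop /asboolP[m [s [sS E]]] p pp pA.
have n0 : ((\prod_(q <- s) q)%N%:R != 0 :> rat)%R.
  rewrite pnatr_eq0 -lt0n big_seq prodn_cond_gt0 // => q /sS/Sp; exact: prime_gt0.
have A0' : (A%:~R != 0 :> rat)%R by rewrite intr_eq0.
have {}E : (B * (\prod_(q <- s) q)%N%:Z = m * A)%R.
  apply: (@intr_inj rat); rewrite !intrM -!pmulrn.
  by move/eqP: E; rewrite eqr_div // => /eqP.
(* Being coprime to [B], [A] divides the denominator, a product of primes of [S]. *)
have : (A %| (B * (\prod_(q <- s) q)%N%:Z)%R)%Z by rewrite E dvdz_mull.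
rewrite Gauss_dvdzr // dvdzE absz_nat => /(dvdn_trans pA).
rewrite Euclid_dvd_prod // big_has => /hasP[q qs] /=.
have Sq := sS q qs; rewrite dvdn_prime2 ?(Sp q) // => /eqP ->; exact: Sq.
Qed.

Lemma coprimez_subl (X Y : int) :
  coprimez X Y -> coprimez (Y - X) Y /\ coprimez X (Y - X).
Proof.
case/coprimezP=> -[u v] /= uv; split; apply/coprimezP.
  by exists (- u, u + v)%R; rewrite /= -uv; ring.
by exists (u + v, v)%R; rewrite /= -uv; ring.
Qed.

(** Among X, Y and Y - X, the largest absolute value is the sum of the other two; the signs of X and
    Y - X decide which. *)
Lemma smooth_sum_abs (s : seq nat) (X Y : int) :
  (0 < Y)%R -> X != 0%R -> (Y - X)%R != 0%R -> coprimez X Y ->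
  (forall p, prime p -> p %| `|X| -> p \in s) ->
  (forall p, prime p -> p %| `|Y| -> p \in s) ->
  (forall p, prime p -> p %| `|(Y - X)%R| -> p \in s) ->
  exists a b, [/\ smooth_sum s a b, `|X| <= a + b & `|Y| <= a + b].
Proof.
move=> Y0 X0 YX0 cop sX sY sYX.
have dvd3 (x y z p : nat) : prime p -> p %| x * y * z ->
    [|| p %| x, p %| y | p %| z].
  by move=> pp; rewrite !Euclid_dvdM // orbA.
have copN : coprime `|X| `|Y| by [].
have [] := coprimez_subl cop; rewrite coprimez_sym !coprimezE => copY copX.
have [Xneg|Xpos] := ltrP X 0%R.
  exists `|X|, `|Y|; split; [|lia|lia]; split; [lia|lia|by []|].
  move=> p pp; have -> : `|X| + `|Y| = `|(Y - X)%R| by lia.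
  by move=> /(dvd3 _ _ _ _ pp)/or3P[/sX|/sY|/sYX]; apply.
have [XY|XY] := ltrP X Y.
  have E : `|X| + `|(Y - X)%R| = `|Y| by lia.
  exists `|X|, `|(Y - X)%R|; split; [|lia|lia]; split; [lia|lia|by []|].
  by move=> p pp; rewrite E => /(dvd3 _ _ _ _ pp)/or3P[/sX|/sYX|/sY]; apply.
have E : `|Y| + `|(Y - X)%R| = `|X| by lia.
exists `|Y|, `|(Y - X)%R|; split; [|lia|lia]; split; [lia|lia|by []|].
by move=> p pp; rewrite E => /(dvd3 _ _ _ _ pp)/or3P[/sY|/sYX|/sX]; apply.
Qed.

Lemma finite_rat_bounded B :
  finite_set [set x : rat | `|numq x| <= B /\ `|denq x| <= B]%classic.
Proof.
pose r := index_iota 0 B.+1.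
pose f (u : nat * nat) : rat := (u.1%:Z%:~R / u.2%:Z%:~R)%R.
pose l := [seq f (m, n) | m <- r, n <- r].
apply: (@sub_finite_set _ _ [set` (l ++ map -%R%R l)]%classic); last first.
  by apply/finite_seqP; exists (l ++ map -%R%R l).
move=> x [hn hd]; suff : x \in l ++ map -%R%R l by [].
have xE : x = (if (numq x < 0)%R then - f (`|numq x|, `|denq x|)%N
    else f (`|numq x|, `|denq x|)%N)%R.
  rewrite /f /= absz_denq -[LHS]divq_num_den; case: ltrP => h.
    by rewrite ltz0_abs // rmorphN mulNr opprK.
  by rewrite gez0_abs.
have fl : f (`|numq x|, `|denq x|)%N \in l.
  by apply/allpairsP; exists (`|numq x|, `|denq x|);
    rewrite !mem_index_iota /= !ltnS.
rewrite mem_cat xE; case: ifP => _; last by rewrite fl.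
by rewrite map_f ?orbT.
Qed.

Theorem mainTheorem1 (S : set nat) (S_finite : finite_set S)
    (S_prime : forall p : nat, S p -> prime p) :
  finite_set (P1minus3_points (Sinteger S)).
Proof.
have [s0 S_s0] := (finite_seqP S).1 S_finite.
pose s := undup s0.
have sS p : p \in s <-> S p by rewrite mem_undup S_s0.
have [B HB] := @smooth_sum_height_bounded s (undup_uniq _)
  (fun p ps => prime_gt0 (S_prime p ((sS p).1 ps))).
apply: (@sub_finite_set _ _ ((fun u : Sinteger S => val u) @^-1`
  [set x : rat | `|numq x| <= 2 ^ B.+1 /\ `|denq x| <= 2 ^ B.+1])%classic);
  last first.
  apply: finite_preimage (finite_rat_bounded _).
  by move=> u v _ _; apply: val_inj.
move=> u [/andP[u0 uV] /andP[v0 vV]] /=.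
set x := val u in u0 uV *.
have {v0} v0 : (1 - x != 0)%R by [].
have {vV} vV : ((1 - x)^-1)%R \in Sintegral S by [].
have xS : x \in Sintegral S by apply: valP.
have Y0 : (0 < denq x)%R := denq_gt0 x.
have Yn0 : ((denq x)%:~R != 0 :> rat)%R by rewrite intr_eq0 gt_eqF.
have xE : x = ((numq x)%:~R / (denq x)%:~R)%R by rewrite divq_num_den.
have vE : (1 - x = (denq x - numq x)%:~R / (denq x)%:~R)%R.
  by rewrite intrD mulrDl divff // rmorphN mulNr -xE.
have X0 : numq x != 0%R by rewrite numq_eq0.
have YX0 : (denq x - numq x)%R != 0%R.
  by apply: contraNneq v0 => e; rewrite vE e mul0r.
have cop : coprimez (numq x) (denq x) := coprime_num_den x.
(* Integrality of 1/x, x and 1/(1 - x) controls the primes of [numq x], [denq x] and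
   [denq x - numq x] respectively. *)
have [|||a [b [sab ha hb]]] := @smooth_sum_abs s _ _ Y0 X0 YX0 cop.
- move=> p pp pX; apply/sS; apply: (Sintegral_div_supp S_prime X0 cop _ pp pX).
  by rewrite -invf_div -xE.
- move=> p pp pX; apply/sS.
  apply: (Sintegral_div_supp (B := numq x) S_prime _ _ _ pp pX).
  - by rewrite gt_eqF.
  - by rewrite coprimez_sym.
  - by rewrite -xE.
- move=> p pp pX; apply/sS.
  apply: (Sintegral_div_supp (B := denq x) S_prime YX0 _ _ pp pX).
    by have [] := coprimez_subl cop.
  by rewrite -invf_div -vE.
have cB : a + b <= 2 ^ B.+1.
  apply/ltnW/(leq_trans (trunc_log_ltn _ (ltnSn 1))).
  by rewrite leq_exp2l // ltnS; apply: HB.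
by split; apply: leq_trans cB.
Qed.
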